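(* Let $\Sigma$ be a closed geodesic in $\mathbb{T}^2$. Then there is a constant $C_\Sigma>0$, independent of $\lambda$, such that for every $\lambda>1$ and every eigenfunction $e_\lambda$ on $\mathbb{T}^2$ with $-\Delta e_\lambda=\lambda^2e_\lambda$, $$\|e_\lambda\|_{L^2(\Sigma)}\le C_\Sigma\|e_\lambda\|_{L^2(\mathbb{T}^2)}.$$
   Context: $\mathbb{T}^2=\mathbb{R}^2/(2\pi\mathbb{Z})^2$ is the standard flat torus and $\Delta$ its Laplace-Beltrami operator. Eigenfunctions are complex valued; those with $-\Delta e_\lambda=\lambda^2e_\lambda$ are exactly the finite sums $e_\lambda(x)=\sum_{n\in\mathbb{Z}^2,\,|n|=\lambda}c_ne^{in\cdot x}$. $L^2(\Sigma)$ is taken with respect to arc length. *)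

(* Defs.v *)
From Stdlib Require Import Reals.
From Coquelicot Require Import Coquelicot.
Open Scope R_scope.

(** Functions on the torus R^2/(2 pi Z)^2 are encoded as functions on the plane
    that are 2 pi-periodic in each variable; curves in the torus are encoded by
    their lifts to the plane. *)

Definition torus_function (e : R -> R -> C) : Prop :=
  forall x y, e (x + 2 * PI) y = e x y /\ e x (y + 2 * PI) = e x y.

Definition torus_eq (p q : R * R) : Prop :=
  exists k l : Z,
    fst p = fst q + 2 * PI * IZR k /\ snd p = snd q + 2 * PI * IZR l.

Definition C2 (e : R -> R -> C) : Prop :=
  forall x y,
    ex_diff_n (fun x y => Re (e x y)) 2 x y /\
    ex_diff_n (fun x y => Im (e x y)) 2 x y.

Definition real_laplacian (u : R -> R -> R) (x y : R) : R :=
  Derive_n (fun z => u z y) 2 x + Derive_n (fun z => u x z) 2 y.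

Definition laplacian (e : R -> R -> C) (x y : R) : C :=
  (real_laplacian (fun x y => Re (e x y)) x y,
   real_laplacian (fun x y => Im (e x y)) x y).

Definition eigenfunction (lambda : R) (e : R -> R -> C) : Prop :=
  torus_function e /\ C2 e /\
  forall x y, Copp (laplacian e x y) = Cmult (RtoC (lambda ^ 2)) (e x y).

(** In the flat metric the Christoffel symbols vanish, so the geodesic equation
    is gamma'' = 0.  The differentiability of gamma itself has to be required
    separately because [Derive] is total. *)
Definition unit_speed_geodesic (gamma : R -> R * R) : Prop :=
  let g1 := fun t => fst (gamma t) in
  let g2 := fun t => snd (gamma t) in
  forall t,
    ex_derive g1 t /\ ex_derive g2 t /\
    is_derive (Derive g1) t 0 /\ is_derive (Derive g2) t 0 /\
    Derive g1 t ^ 2 + Derive g2 t ^ 2 = 1.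

Definition is_period (gamma : R -> R * R) (T : R) : Prop :=
  forall t, torus_eq (gamma (t + T)) (gamma t).

(** [len] is the least positive period, so [gamma] restricted to [0, len) runs
    through the closed geodesic exactly once, by arc length. *)
Definition closed_geodesic (gamma : R -> R * R) (len : R) : Prop :=
  unit_speed_geodesic gamma /\
  0 < len /\ is_period gamma len /\
  (forall T, 0 < T < len -> ~ is_period gamma T).

(** Both norms are only applied to continuous functions, for which the (iterated)
    Riemann integrals agree with the Lebesgue integrals. *)
Definition L2_norm_torus (e : R -> R -> C) : R :=
  sqrt (RInt (fun x => RInt (fun y => Cmod (e x y) ^ 2) 0 (2 * PI)) 0 (2 * PI)).

Definition L2_norm_curve (gamma : R -> R * R) (len : R) (e : R -> R -> C) : R :=
  sqrt (RInt (fun t => Cmod (e (fst (gamma t)) (snd (gamma t))) ^ 2) 0 len).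

(* Main.v *)
Require Import Defs.
From Stdlib Require Import Reals ZArith Lra Lia.
From Coquelicot Require Import Coquelicot.
Open Scope R_scope.

(** Let v be the velocity of the geodesic and Phi(x) the integral of u^2, u a
    real eigenfunction, along the segment of direction v and length len starting
    at x.  In coordinates (s, t) along v and its orthogonal, the correlation
    K(t, t') of u(., t) and u(., t') over one period satisfies K_tt = K_t't',
    because d^2/dt^2 u = - (d^2/ds^2 + lambda^2) u and d^2/ds^2 is symmetric.
    Hence K obeys the parallelogram identity
    K(2t, 0) + K(0, 0) = K(t, t) + K(t, -t), and completing squares gives
    Phi(p) <= 3 Phi(p + y) + Phi(p - y) + Phi(p + 2 y) for every y in the plane,
    with no dependence on lambda.  Averaging over y in the torus bounds Phi(p) by
    5 len / (2 pi)^2 times the integral of u^2 over the torus. *)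

(* The type of a real integral is a coercion of [R_CompleteNormedModule] that
   [ring] and [field] do not recognize. *)
Ltac real_eq :=
  repeat match goal with
  | |- context [@RInt R_CompleteNormedModule ?f ?a ?b] =>
      let J := fresh "J" in
      refine (let J : R := @RInt R_CompleteNormedModule f a b in _);
      change (@RInt R_CompleteNormedModule f a b) with J;
      clearbody J
  end;
  match goal with |- @eq _ ?x ?y => change (@eq R x y) end.

(** * Continuity of composite real expressions *)

Section Continuity.

Context {U : UniformSpace}.
Implicit Types f g : U -> R.

Lemma continuous_Rplus f g z :
  continuous f z -> continuous g z -> continuous (fun z => f z + g z) z.
Proof. exact (continuous_plus f g z). Qed.

Lemma continuous_Rminus f g z :
  continuous f z -> continuous g z -> continuous (fun z => f z - g z) z.
Proof. exact (continuous_minus f g z). Qed.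

Lemma continuous_Rmult f g z :
  continuous f z -> continuous g z -> continuous (fun z => f z * g z) z.
Proof. exact (continuous_mult f g z). Qed.

Lemma continuous_Ropp f z : continuous f z -> continuous (fun z => - f z) z.
Proof. exact (continuous_opp f z). Qed.

Lemma continuous_pow f n z :
  continuous f z -> continuous (fun z => f z ^ n) z.
Proof.
intros Hf; induction n as [|n IHn]; simpl.
- apply continuous_const.
- now apply continuous_Rmult.
Qed.

End Continuity.

(** Phrased on the product uniform space so that the general composition lemmas apply.
    [jointly_continuous_2d_pt] translates to the epsilon-delta form that the theorems on parametric
    integrals expect. *)
Definition jointly_continuous (f : R -> R -> R) : Prop :=
  forall z : R * R, continuous (fun z => f (fst z) (snd z)) z.

Lemma continuous_proj1 (z : R * R) : continuous fst z.
Proof. destruct z; apply continuous_fst. Qed.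

Lemma continuous_proj2 (z : R * R) : continuous snd z.
Proof. destruct z; apply continuous_snd. Qed.

Lemma continuous_jointly {U : UniformSpace} (h : R -> R -> R) (f g : U -> R) z :
  jointly_continuous h -> continuous f z -> continuous g z ->
  continuous (fun z => h (f z) (g z)) z.
Proof. intros Hh Hf Hg; apply continuous_comp_2; auto. Qed.

Lemma continuous_global {U : UniformSpace} (h : R -> R) (f : U -> R) z :
  (forall x, continuous h x) -> continuous f z ->
  continuous (fun z => h (f z)) z.
Proof. intros Hh Hf; apply continuous_comp; auto. Qed.

(** Recursion on the shape of the expression. Function symbols such as [w] or [X] are treated as
    heads whose continuity is looked up in the context. *)
Ltac continuity :=
  repeat (cbv beta; match goal with
  | |- continuous (fun _ => ?c) _ => apply continuous_const
  | |- continuous (fun z => z) _ => apply continuous_id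
  | |- continuous (fun z => fst z) _ => apply continuous_proj1
  | |- continuous (fun z => snd z) _ => apply continuous_proj2
  | |- continuous (fun z => _ + _) _ => apply continuous_Rplus
  | |- continuous (fun z => _ - _) _ => apply continuous_Rminus
  | |- continuous (fun z => _ * _) _ => apply continuous_Rmult
  | |- continuous (fun z => - _) _ => apply continuous_Ropp
  | |- continuous (fun z => _ ^ _) _ => apply continuous_pow
  | |- continuous (fun z => ?h (@?f z) (@?g z)) _ =>
      apply (continuous_jointly h f g); [assumption | |]
  | |- continuous (fun z => ?h (@?f z)) _ =>
      apply (continuous_global h f); [assumption |]
  | |- continuous (?h ?x) ?y => change (continuous (fun z => h x z) y)
  | H : forall x, continuous ?h x |- continuous ?h _ => apply H
  end).

(** * Integrals depending on a parameter and exchange of integrals *)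

Lemma jointly_continuous_2d_pt (f : R -> R -> R) :
  jointly_continuous f <-> forall x y, continuity_2d_pt f x y.
Proof.
split.
- intros Hf x y; apply continuity_2d_pt_filterlim, (Hf (x, y)).
- intros Hf [x y]; apply (continuity_2d_pt_filterlim f x y), Hf.
Qed.

Lemma ex_RInt_continuous_global (f : R -> R) a b :
  (forall x, continuous f x) -> ex_RInt f a b.
Proof.
intros Hf; apply (ex_RInt_continuous (V := R_CompleteNormedModule)); auto.
Qed.

Lemma continuous_RInt_param_le (f : R -> R -> R) a b x :
  jointly_continuous f -> a <= b -> continuous (fun x => RInt (f x) a b) x.
Proof.
intros Hf Hab.
assert (Hex : forall x, ex_RInt (f x) a b).
{ intros y; apply ex_RInt_continuous_global; intros s; continuity. }
apply filterlim_locally; intros eps.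
(* The added 1 keeps the denominator positive when [a = b], and leaves room for the strict
   inequality at the end. *)
assert (He : 0 < eps / (b - a + 1)).
{ apply Rdiv_lt_0_compat; [apply cond_pos | lra]. }
destruct (uniform_continuity_2d_1d' f a b x
            (fun s _ => proj1 (jointly_continuous_2d_pt f) Hf x s)
            (mkposreal _ He)) as [delta Hdelta]; simpl in Hdelta.
exists delta; intros y Hy; change (Rabs (y - x) < delta) in Hy.
change (Rabs (RInt (f y) a b - RInt (f x) a b) < eps).
assert (E : RInt (f y) a b - RInt (f x) a b = RInt (fun s => f y s - f x s) a b).
{ symmetry; apply (RInt_minus (f y) (f x)); auto. }
rewrite E.
apply Rle_lt_trans with ((b - a) * (eps / (b - a + 1))).
- apply abs_RInt_le_const; auto.
  + apply ex_RInt_continuous_global; intros s; continuity.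
  + intros s Hs; apply Rlt_le.
    assert (H0 := cond_pos delta).
    apply Hdelta; auto; try lra.
    * apply Rabs_lt_between in Hy; lra.
    * rewrite Rminus_diag, Rabs_R0; lra.
- apply Rlt_le_trans with ((b - a + 1) * (eps / (b - a + 1))).
  + apply Rmult_lt_compat_r; lra.
  + right; field; lra.
Qed.

Lemma continuous_RInt_param (f : R -> R -> R) a b x :
  jointly_continuous f -> continuous (fun x => RInt (f x) a b) x.
Proof.
intros Hf; destruct (Rle_dec a b) as [Hab | Hab].
- now apply continuous_RInt_param_le.
- apply continuous_ext with (fun x => - RInt (f x) b a).
  + intros y; apply (opp_RInt_swap (f y)).
    apply ex_RInt_continuous_global; intros s; continuity.
  + apply continuous_Ropp, continuous_RInt_param_le; auto; lra.
Qed.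

Lemma is_derive_RInt_jointly (f df : R -> R -> R) a b x :
  (forall x s, continuous (f x) s) -> jointly_continuous df ->
  (forall x s, is_derive (fun x => f x s) x (df x s)) ->
  is_derive (fun x => RInt (f x) a b) x (RInt (df x) a b).
Proof.
intros Hf Hdf Hd.
replace (RInt (df x) a b)
  with (RInt (fun s => Derive (fun x => f x s) x) a b).
2: { apply RInt_ext; intros s _; apply is_derive_unique, Hd. }
apply (is_derive_RInt_param f a b x).
- apply filter_forall; intros y s _; eexists; apply Hd.
- intros s _; apply continuity_2d_pt_ext with df.
  + intros u v; symmetry; apply is_derive_unique, Hd.
  + now apply jointly_continuous_2d_pt.
- apply filter_forall; intros y; apply ex_RInt_continuous_global, Hf.
Qed.

Lemma is_derive_zero_const (f : R -> R) :
  (forall x, is_derive f x 0) -> forall x y, f x = f y.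
Proof.
intros Hf.
assert (Hlt : forall x y, x < y -> f x = f y).
{ intros x y Hxy; apply (eq_is_derive f x y); auto. }
intros x y; destruct (Rtotal_order x y) as [H | [-> | H]]; auto.
symmetry; auto.
Qed.

Lemma is_derive_RInt_upper (f : R -> R) a x :
  (forall x, continuous f x) -> is_derive (fun x => RInt f a x) x (f x).
Proof.
intros Hf; apply is_derive_RInt with a; auto.
apply filter_forall; intros y.
apply (RInt_correct f), ex_RInt_continuous_global, Hf.
Qed.

(** Fubini by differentiation in the upper limit: replace [b] by [r]; both iterated integrals have
    derivative [RInt (f r) c d] in [r], and both vanish at [r = a]. *)
Lemma RInt_swap_continuous (f : R -> R -> R) a b c d :
  jointly_continuous f ->
  RInt (fun x => RInt (fun y => f x y) c d) a b =
  RInt (fun y => RInt (fun x => f x y) a b) c d.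
Proof.
intros Hf.
assert (Hf' : jointly_continuous (fun x y => f y x)).
{ intros z; continuity. }
set (D := fun r => RInt (fun x => RInt (fun y => f x y) c d) a r -
                   RInt (fun y => RInt (fun x => f x y) a r) c d).
assert (HD : D b = D a).
{ apply is_derive_zero_const; intros r; unfold D.
  rewrite <- (Rminus_diag (RInt (fun y => f r y) c d)).
  apply (is_derive_minus (V := R_NormedModule)).
  - apply (is_derive_RInt_upper (fun x => RInt (fun y => f x y) c d)).
    intros x; now apply continuous_RInt_param.
  - apply (is_derive_RInt_jointly (fun r y => RInt (fun x => f x y) a r) f).
    + intros x s; now apply (continuous_RInt_param (fun y x => f x y)).
    + exact Hf.
    + intros x s; apply (is_derive_RInt_upper (fun x => f x s)).
      intros y; continuity. }
unfold D in HD.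
rewrite (RInt_point a (fun x => RInt (fun y => f x y) c d)) in HD.
rewrite (RInt_ext (fun y => RInt (fun x => f x y) a a) (fun _ => 0)) in HD.
2: { intros y _; apply (RInt_point a (fun x => f x y)). }
rewrite RInt_const in HD.
change (scal (d - c) 0) with ((d - c) * 0) in HD.
change (@zero R_CompleteNormedModule) with 0 in HD.
lra.
Qed.

(** * The wave equation and its parallelogram identity *)

Lemma is_derive_comp_affine (g dg : R -> R) (c d x : R) :
  (forall t, is_derive g t (dg t)) ->
  is_derive (fun x => g (c * x + d)) x (c * dg (c * x + d)).
Proof.
intros Hg; apply (is_derive_comp g (fun x => c * x + d)); auto.
auto_derive; auto; ring.
Qed.

Lemma is_derive_Rmult (f g : R -> R) (x df dg l : R) :
  is_derive f x df -> is_derive g x dg -> df * g x + f x * dg = l ->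
  is_derive (fun x => f x * g x) x l.
Proof.
intros Hf Hg <-; apply (is_derive_mult f g x df dg Hf Hg Rmult_comm).
Qed.

(* In the coordinates [a + b], [a - b] the wave equation satisfied by
   [fun t t' => RInt (fun s => u s t * u s t') 0 L] says that the mixed
   derivative of [N] below vanishes. *)
Lemma wave_parallelogram (u ut utt us uss : R -> R -> R) (L mu a : R) :
  jointly_continuous u -> jointly_continuous ut -> jointly_continuous utt ->
  jointly_continuous us -> jointly_continuous uss ->
  (forall s t, is_derive (fun t => u s t) t (ut s t)) ->
  (forall s t, is_derive (fun t => ut s t) t (utt s t)) ->
  (forall s t, is_derive (fun s => u s t) s (us s t)) ->
  (forall s t, is_derive (fun s => us s t) s (uss s t)) ->
  (forall s t, uss s t + utt s t = - mu * u s t) ->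
  (forall t, u L t = u 0 t) -> (forall t, us L t = us 0 t) ->
  RInt (fun s => u s (2 * a) * u s 0) 0 L + RInt (fun s => u s 0 ^ 2) 0 L =
  RInt (fun s => u s a ^ 2) 0 L + RInt (fun s => u s a * u s (- a)) 0 L.
Proof.
intros Cu Cut Cutt Cus Cuss Du Dut Dus Duus PDE Pu Pus.
(* With K the correlation, [N x b] is K(x + b, x - b), and [M b x] is its derivative in [x]. *)
set (N := (fun x b => RInt (fun s => u s (x + b) * u s (x - b)) 0 L)
       : R -> R -> R).
set (M := (fun b x => RInt (fun s => ut s (x + b) * u s (x - b) +
                                     u s (x + b) * ut s (x - b)) 0 L)
       : R -> R -> R).
assert (Dplus_x : forall (g dg : R -> R -> R) s b x,
  (forall s t, is_derive (fun t => g s t) t (dg s t)) ->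
  is_derive (fun x => g s (x + b)) x (dg s (x + b))).
{ intros g dg s b x Hg.
  generalize (is_derive_comp_affine (g s) (dg s) 1 b x (Hg s)).
  rewrite !Rmult_1_l; apply is_derive_ext; intros y; now rewrite Rmult_1_l. }
assert (Dminus_x : forall (g dg : R -> R -> R) s b x,
  (forall s t, is_derive (fun t => g s t) t (dg s t)) ->
  is_derive (fun x => g s (x - b)) x (dg s (x - b))).
{ intros g dg s b x Hg; exact (Dplus_x g dg s (- b) x Hg). }
assert (Dplus_b : forall (g dg : R -> R -> R) s x b,
  (forall s t, is_derive (fun t => g s t) t (dg s t)) ->
  is_derive (fun b => g s (x + b)) b (dg s (x + b))).
{ intros g dg s x b Hg; rewrite Rplus_comm.
  apply is_derive_ext with (fun b => g s (b + x)); auto.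
  intros y; now rewrite Rplus_comm. }
assert (Dminus_b : forall (g dg : R -> R -> R) s x b,
  (forall s t, is_derive (fun t => g s t) t (dg s t)) ->
  is_derive (fun b => g s (x - b)) b (- dg s (x - b))).
{ intros g dg s x b Hg.
  generalize (is_derive_comp_affine (g s) (dg s) (-1) x b (Hg s)).
  replace (-1 * b + x) with (x - b) by ring.
  replace (-1 * dg s (x - b)) with (- dg s (x - b)) by ring.
  apply is_derive_ext; intros y; f_equal; ring. }
assert (DN : forall b x, is_derive (fun x => N x b) x (M b x)).
{ intros b x.
  apply (is_derive_RInt_jointly
           (fun x s => u s (x + b) * u s (x - b))
           (fun x s => ut s (x + b) * u s (x - b) + u s (x + b) * ut s (x - b))).
  - intros y s; continuity.
  - intros z; continuity.
  - intros y s; eapply is_derive_Rmult.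
    + now apply (Dplus_x u ut).
    + now apply (Dminus_x u ut).
    + reflexivity. }
assert (DM : forall x b, is_derive (fun b => M b x) b 0).
{ intros x b.
  evar_last.
  - apply (is_derive_RInt_jointly
           (fun b s => ut s (x + b) * u s (x - b) + u s (x + b) * ut s (x - b))
           (* The two products of first derivatives [ut] have opposite signs and cancel. *)
           (fun b s => utt s (x + b) * u s (x - b) - u s (x + b) * utt s (x - b))).
    + intros y s; continuity.
    + intros z; continuity.
    + intros y s.
      replace (utt s (x + y) * u s (x - y) - u s (x + y) * utt s (x - y))
        with ((utt s (x + y) * u s (x - y) + ut s (x + y) * (- ut s (x - y))) +
              (ut s (x + y) * ut s (x - y) + u s (x + y) * (- utt s (x - y))))
        by ring.
      apply (is_derive_plus (V := R_NormedModule)); eapply is_derive_Rmult;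
        [now apply (Dplus_b ut utt) | now apply (Dminus_b u ut) | reflexivity
        |now apply (Dplus_b u ut) | now apply (Dminus_b ut utt) | reflexivity].
  - rewrite (RInt_ext _ (fun s => u s (x + b) * uss s (x - b) -
                                  uss s (x + b) * u s (x - b))).
    2: { intros s _.
         assert (H1 := PDE s (x + b)); assert (H2 := PDE s (x - b)).
         replace (utt s (x + b)) with (- mu * u s (x + b) - uss s (x + b)) by lra.
         replace (utt s (x - b)) with (- mu * u s (x - b) - uss s (x - b)) by lra.
         real_eq; ring. }
    apply is_RInt_unique.
    evar_last.
    + apply (is_RInt_derive
        (fun s => u s (x + b) * us s (x - b) - us s (x + b) * u s (x - b))).
      * intros s _.
        replace (u s (x + b) * uss s (x - b) - uss s (x + b) * u s (x - b))
          with ((us s (x + b) * us s (x - b) + u s (x + b) * uss s (x - b)) -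
                (uss s (x + b) * u s (x - b) + us s (x + b) * us s (x - b)))
          by ring.
        apply (is_derive_minus (V := R_NormedModule));
          eapply is_derive_Rmult; auto.
      * intros s _; continuity.
    + rewrite !Pu, !Pus; apply Rminus_diag. }
assert (HM : forall b x, M b x = M 0 x).
{ intros b x; apply (is_derive_zero_const (fun b => M b x)); auto. }
(* Since [M] does not depend on [b], [N x a - N x 0] is constant in [x]; it is compared at [x = a]
   and [x = 0]. *)
assert (HN : N a a - N a 0 = N 0 a - N 0 0).
{ apply (is_derive_zero_const (fun x => N x a - N x 0)); intros x.
  evar_last.
  - apply (is_derive_minus (V := R_NormedModule)); apply DN.
  - rewrite (HM a x); apply Rminus_diag. }
(* These four values are K(2a, 0), K(0, 0), K(a, a) and K(a, -a). *)
enough (E : N a a + N 0 0 = N a 0 + N 0 a).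
{ unfold N in E; rewrite !Rplus_0_l, !Rminus_0_r, Rplus_0_r, Rminus_diag in E.
  rewrite (RInt_ext (fun s => u s 0 ^ 2) (fun s => u s 0 * u s 0)).
  2: { intros s _; real_eq; ring. }
  rewrite (RInt_ext (fun s => u s a ^ 2) (fun s => u s a * u s a)).
  2: { intros s _; real_eq; ring. }
  replace (2 * a) with (a + a) by ring.
  rewrite E; f_equal; apply RInt_ext; intros s _; do 2 f_equal; ring. }
lra.
Qed.

(** * Integrals of periodic functions over a period *)

Section Periodic.

Variables (h : R -> R) (T : R).
Hypothesis h_continuous : forall x, continuous h x.
Hypothesis h_periodic : forall x, h (x + T) = h x.

(** The derivative in [d] is [h (d + T) - h d = 0]. In the proof the upper limit is written
    [1 * d + T] to fit [is_derive_comp_affine]. *)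
Lemma RInt_periodic d : RInt h d (d + T) = RInt h 0 T.
Proof.
assert (Hex : forall a b, ex_RInt h a b).
{ intros a b; now apply ex_RInt_continuous_global. }
assert (E : RInt h 0 (1 * d + T) - RInt h 0 d = RInt h 0 (1 * 0 + T) - RInt h 0 0).
{ apply (is_derive_zero_const (fun d => RInt h 0 (1 * d + T) - RInt h 0 d)).
  intros x; evar_last.
  - apply (is_derive_minus (V := R_NormedModule)).
    + apply (is_derive_comp_affine (RInt h 0) h).
      intros t; now apply is_derive_RInt_upper.
    + now apply is_derive_RInt_upper.
  - change (1 * h (1 * x + T) - h x = 0).
    rewrite !Rmult_1_l, h_periodic; ring. }
assert (C : RInt h 0 d + RInt h d (d + T) = RInt h 0 (d + T)).
{ now apply (RInt_Chasles h 0 d (d + T)). }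
rewrite RInt_point in E; change (@zero R_CompleteNormedModule) with 0 in E.
rewrite Rmult_0_r, Rplus_0_l, Rmult_1_l in E; lra.
Qed.

Lemma RInt_comp_affine c d :
  c <> 0 -> RInt (fun y => h (c * y + d)) 0 T = / c * RInt h d (c * T + d).
Proof.
intros Hc.
assert (E : RInt (fun y => c * h (c * y + d)) 0 T = RInt h (c * 0 + d) (c * T + d)).
{ apply (RInt_comp_lin h c d 0 T); now apply ex_RInt_continuous_global. }
assert (E' : RInt (fun y => c * h (c * y + d)) 0 T =
             c * RInt (fun y => h (c * y + d)) 0 T).
{ apply (RInt_scal (fun y => h (c * y + d))).
  apply ex_RInt_continuous_global; intros y; continuity. }
rewrite E', Rmult_0_r, Rplus_0_l in E; rewrite <- E; real_eq; field; auto.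
Qed.

Lemma RInt_periodic_shift d : RInt (fun y => h (d + y)) 0 T = RInt h 0 T.
Proof.
rewrite (RInt_ext _ (fun y => h (1 * y + d))).
2: { intros y _; f_equal; ring. }
rewrite RInt_comp_affine, Rmult_1_l, (Rplus_comm T), RInt_periodic by lra.
real_eq; field.
Qed.

Lemma RInt_periodic_reflect d : RInt (fun y => h (d - y)) 0 T = RInt h 0 T.
Proof.
rewrite (RInt_ext _ (fun y => h (-1 * y + d))).
2: { intros y _; f_equal; ring. }
rewrite RInt_comp_affine by lra.
assert (E : - RInt h d (-1 * T + d) = RInt h (-1 * T + d) d).
{ apply (opp_RInt_swap h d (-1 * T + d)).
  now apply ex_RInt_continuous_global. }
(* The reversed orientation absorbs the factor -1, leaving a full period that starts at [d - T]. *)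
rewrite <- (RInt_periodic (-1 * T + d)).
replace (-1 * T + d + T) with d by ring.
rewrite <- E; real_eq; field.
Qed.

(** The substitution gives half of an integral over two consecutive periods. *)
Lemma RInt_periodic_double d : RInt (fun y => h (d + 2 * y)) 0 T = RInt h 0 T.
Proof.
rewrite (RInt_ext _ (fun y => h (2 * y + d))).
2: { intros y _; f_equal; ring. }
rewrite RInt_comp_affine by lra.
assert (E : RInt h d (d + T) + RInt h (d + T) (d + T + T) = RInt h d (d + T + T)).
{ apply (RInt_Chasles h d (d + T) (d + T + T));
    now apply ex_RInt_continuous_global. }
rewrite !RInt_periodic in E.
replace (2 * T + d) with (d + T + T) by ring.
rewrite <- E; real_eq; field.
Qed.

End Periodic.

(** The inequality is integrated in [y] over one period, where translation, reflection and doubling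
    all preserve the integral. Three separate functions are allowed because the first coordinate is
    still shifted differently in each term when the second one is averaged. *)
Lemma RInt_periodic_average (f g h : R -> R) (T c d : R) :
  (forall x, continuous f x) -> (forall x, continuous g x) ->
  (forall x, continuous h x) ->
  (forall x, f (x + T) = f x) -> (forall x, g (x + T) = g x) ->
  (forall x, h (x + T) = h x) -> 0 <= T ->
  (forall y, c <= 3 * f (d + y) + g (d - y) + h (d + 2 * y)) ->
  T * c <= 3 * RInt f 0 T + RInt g 0 T + RInt h 0 T.
Proof.
intros Cf Cg Ch Pf Pg Ph HT Hc.
assert (Hex : forall f : R -> R, (forall x, continuous f x) -> ex_RInt f 0 T).
{ intros k Hk; now apply ex_RInt_continuous_global. }
replace (T * c) with (RInt (fun _ => c) 0 T).
2: { rewrite RInt_const; change ((T - 0) * c = T * c); ring. }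
replace (3 * RInt f 0 T + RInt g 0 T + RInt h 0 T)
  with (RInt (fun y => 3 * f (d + y) + g (d - y) + h (d + 2 * y)) 0 T).
- apply RInt_le; auto; apply Hex; intros x; continuity.
- assert (E1 : RInt (fun y => 3 * f (d + y) + g (d - y) + h (d + 2 * y)) 0 T =
               RInt (fun y => 3 * f (d + y) + g (d - y)) 0 T +
               RInt (fun y => h (d + 2 * y)) 0 T).
  { apply (RInt_plus (fun y => 3 * f (d + y) + g (d - y)));
      apply Hex; intros x; continuity. }
  assert (E2 : RInt (fun y => 3 * f (d + y) + g (d - y)) 0 T =
               RInt (fun y => 3 * f (d + y)) 0 T + RInt (fun y => g (d - y)) 0 T).
  { apply (RInt_plus (fun y => 3 * f (d + y))); apply Hex; intros x; continuity. }
  assert (E3 : RInt (fun y => 3 * f (d + y)) 0 T =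
               3 * RInt (fun y => f (d + y)) 0 T).
  { apply (RInt_scal (fun y => f (d + y))); apply Hex; intros x; continuity. }
  rewrite E1, E2, E3, (RInt_periodic_shift f), (RInt_periodic_reflect g),
    (RInt_periodic_double h) by assumption.
  reflexivity.
Qed.

(** * Partial derivatives and the chain rule in the plane *)

Definition partial1 (w : R -> R -> R) (x y : R) : R := Derive (fun z => w z y) x.

Definition partial2 (w : R -> R -> R) (x y : R) : R := Derive (fun z => w x z) y.

Definition continuously_differentiable (w : R -> R -> R) : Prop :=
  (forall x y, ex_derive (fun z => w z y) x) /\
  (forall x y, ex_derive (fun z => w x z) y) /\
  jointly_continuous w /\
  jointly_continuous (partial1 w) /\ jointly_continuous (partial2 w).

Lemma ex_diff_2_continuously_differentiable (w : R -> R -> R) :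
  (forall x y, ex_diff_n w 2 x y) ->
  continuously_differentiable w /\
  continuously_differentiable (partial1 w) /\
  continuously_differentiable (partial2 w).
Proof.
intros Hw.
(* [ex_diff_n] unfolds to a conjunction at each point. [H] turns each goal into a pointwise one, so
   that its conjunct can be extracted propositionally. *)
assert (H : forall P : R -> R -> Prop,
  (forall x y, ex_diff_n w 2 x y -> P x y) -> forall x y, P x y) by auto.
repeat split; try apply jointly_continuous_2d_pt;
  apply H; intros x y Hxy; simpl in Hxy; unfold partial1, partial2; tauto.
Qed.

(** Existence of both partial derivatives and continuity of the first make [w] differentiable at the
    point, and the chain rule follows. The free value [l] lets the derivative be supplied in any
    equal form. *)
Lemma is_derive_comp_plane (w : R -> R -> R) (f g : R -> R) (t a b l : R) :
  continuously_differentiable w -> is_derive f t a -> is_derive g t b ->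
  a * partial1 w (f t) (g t) + b * partial2 w (f t) (g t) = l ->
  is_derive (fun t => w (f t) (g t)) t l.
Proof.
intros (D1 & D2 & C0 & C1 & C2) Hf Hg <-.
apply is_derive_Reals.
rewrite (Rmult_comm a), (Rmult_comm b).
apply derivable_pt_lim_comp_2d; [| now apply is_derive_Reals ..].
apply filterdiff_differentiable_pt_lim.
apply (is_derive_filterdiff w (f t) (g t) (partial1 w) (partial2 w (f t) (g t))).
- apply filter_forall; intros z; apply Derive_correct, D1.
- apply Derive_correct, D2.
- apply C1.
Qed.

Lemma partial1_periodic (w : R -> R -> R) (a b x y : R) :
  (forall x y, ex_derive (fun z => w z y) x) ->
  (forall x y, w (x + a) (y + b) = w x y) ->
  partial1 w (x + a) (y + b) = partial1 w x y.
Proof.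
intros Hd Hp; symmetry; apply is_derive_unique.
apply is_derive_ext with (fun z => w (1 * z + a) (y + b)).
- intros z; rewrite Rmult_1_l; apply Hp.
- evar_last.
  + apply (is_derive_comp_affine (fun z => w z (y + b))
             (fun z => partial1 w z (y + b))).
    intros t; apply Derive_correct, Hd.
  + now rewrite !Rmult_1_l.
Qed.

Lemma partial2_periodic (w : R -> R -> R) (a b x y : R) :
  (forall x y, ex_derive (fun z => w x z) y) ->
  (forall x y, w (x + a) (y + b) = w x y) ->
  partial2 w (x + a) (y + b) = partial2 w x y.
Proof.
intros Hd Hp.
apply (partial1_periodic (fun y x => w x y) b a y x); auto.
Qed.

(** * Integrals along a segment and their average over the torus *)

Definition segment_integral (F : R -> R -> R) (v1 v2 L x y : R) : R :=
  RInt (fun s => F (x + s * v1) (y + s * v2)) 0 L.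

(** Sliding the starting point along the direction of the segment only shifts the integration
    variable of an [L]-periodic integrand. *)
Lemma segment_integral_periodic (F : R -> R -> R) (v1 v2 L x y r : R) :
  jointly_continuous F ->
  (forall x y, F (x + L * v1) (y + L * v2) = F x y) ->
  segment_integral F v1 v2 L (x + r * v1) (y + r * v2) =
  segment_integral F v1 v2 L x y.
Proof.
intros CF PF; unfold segment_integral.
rewrite <- (RInt_periodic_shift (fun s => F (x + s * v1) (y + s * v2)) L)
  with (d := r).
- apply RInt_ext; intros s _; f_equal; ring.
- intros s; continuity.
- intros s; rewrite <- (PF (x + s * v1)); f_equal; ring.
Qed.

Lemma segment_integral_plus (F G : R -> R -> R) (v1 v2 L x y : R) :
  jointly_continuous F -> jointly_continuous G ->
  segment_integral (fun x y => F x y + G x y) v1 v2 L x y =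
  segment_integral F v1 v2 L x y + segment_integral G v1 v2 L x y.
Proof.
intros CF CG.
apply (RInt_plus (fun s => F (x + s * v1) (y + s * v2)));
  apply ex_RInt_continuous_global; intros s; continuity.
Qed.

(** The inequality is integrated over [b] and then over [a], each across one period. Every segment
    integral on the right then contributes [L] times the integral of [F] over the torus, and the
    coefficients add up to 3 + 1 + 1 = 5. *)
Lemma segment_integral_average (F : R -> R -> R) (v1 v2 L T x y : R) :
  jointly_continuous F -> 0 <= L -> 0 <= T ->
  (forall x y, F (x + T) y = F x y) -> (forall x y, F x (y + T) = F x y) ->
  (forall a b, segment_integral F v1 v2 L x y <=
     3 * segment_integral F v1 v2 L (x + a) (y + b) +
     segment_integral F v1 v2 L (x - a) (y - b) +
     segment_integral F v1 v2 L (x + 2 * a) (y + 2 * b)) ->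
  T ^ 2 * segment_integral F v1 v2 L x y <=
  5 * L * RInt (fun x => RInt (fun y => F x y) 0 T) 0 T.
Proof.
intros CF HL HT P1 P2 Hineq.
set (G := (fun x => RInt (fun y => F x y) 0 T) : R -> R).
set (A := (fun x => RInt (fun s => G (x + s * v1)) 0 L) : R -> R).
assert (CG : forall x, continuous G x).
{ intros z; now apply continuous_RInt_param. }
assert (PG : forall x, G (x + T) = G x).
{ intros z; apply RInt_ext; auto. }
assert (CA : forall x, continuous A x).
{ intros z; apply (continuous_RInt_param (fun x s => G (x + s * v1))).
  intros p; continuity. }
assert (PA : forall x, A (x + T) = A x).
{ intros z; apply RInt_ext; intros s _.
  rewrite <- (PG (z + s * v1)); f_equal; ring. }
(* After the exchange of integrals, each fixed [s] gives an integral over a full period in [y],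
   which does not see the shift [s * v2]. The same argument in the first coordinate gives [EI]. *)
assert (EA : forall x, RInt (fun y => segment_integral F v1 v2 L x y) 0 T = A x).
{ intros z; unfold segment_integral, A, G.
  rewrite (RInt_swap_continuous (fun y s => F (z + s * v1) (y + s * v2))).
  2: { intros p; continuity. }
  apply RInt_ext; intros s _.
  rewrite <- (RInt_periodic_shift (fun y => F (z + s * v1) y) T)
    with (d := s * v2); auto.
  - apply RInt_ext; intros r _; f_equal; ring.
  - intros r; continuity. }
assert (EI : RInt A 0 T = L * RInt G 0 T).
{ unfold A.
  rewrite (RInt_swap_continuous (fun x s => G (x + s * v1))).
  2: { intros p; continuity. }
  rewrite (RInt_ext _ (fun _ => RInt G 0 T)).
  2: { intros s _.
       rewrite <- (RInt_periodic_shift G T CG PG (s * v1)).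
       apply RInt_ext; intros r _; f_equal; ring. }
  rewrite RInt_const; change ((L - 0) * RInt G 0 T = L * RInt G 0 T).
  real_eq; ring. }
assert (CS : forall x y, continuous (fun y => segment_integral F v1 v2 L x y) y).
{ intros z r.
  apply (continuous_RInt_param (fun y s => F (z + s * v1) (y + s * v2))).
  intros p; continuity. }
assert (PS : forall x y, segment_integral F v1 v2 L x (y + T) =
                         segment_integral F v1 v2 L x y).
{ intros z r; apply RInt_ext; intros s _.
  rewrite <- (P2 _ (r + s * v2)); f_equal; ring. }
(* First average, over [b]; the second, over [a], ends the proof with [A] in all three roles. *)
assert (H1 : forall a, T * segment_integral F v1 v2 L x y <=
                       3 * A (x + a) + A (x - a) + A (x + 2 * a)).
{ intros a; rewrite <- !EA.
  apply (RInt_periodic_average (segment_integral F v1 v2 L (x + a))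
           (segment_integral F v1 v2 L (x - a))
           (segment_integral F v1 v2 L (x + 2 * a)) T _ y); auto. }
replace (T ^ 2 * segment_integral F v1 v2 L x y)
  with (T * (T * segment_integral F v1 v2 L x y)) by ring.
replace (5 * L * RInt G 0 T) with (3 * RInt A 0 T + RInt A 0 T + RInt A 0 T).
2: { rewrite EI; real_eq; ring. }
now apply (RInt_periodic_average A A A T _ x).
Qed.

(** * The inequality for a real eigenfunction *)

Section Segment.

Variables (w : R -> R -> R) (v1 v2 L lambda : R).
Hypothesis w_C2 : forall x y, ex_diff_n w 2 x y.
Hypothesis w_eigen : forall x y, real_laplacian w x y = - lambda ^ 2 * w x y.
Hypothesis v_unit : v1 ^ 2 + v2 ^ 2 = 1.
Hypothesis w_periodic : forall x y, w (x + L * v1) (y + L * v2) = w x y.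
Hypothesis L_nonneg : 0 <= L.

(** This is [wave_parallelogram] in the orthonormal coordinates (s, t) with axes [(v1, v2)] and
    [(- v2, v1)]. The Laplacian is rotation invariant, so the eigenvalue equation keeps its form,
    and invariance of [w] under [(L * v1, L * v2)] gives periodicity in s. *)
Lemma segment_integral_parallelogram x y t :
  RInt (fun s => w (x + s * v1 - 2 * t * v2) (y + s * v2 + 2 * t * v1) *
                 w (x + s * v1) (y + s * v2)) 0 L +
  segment_integral (fun x y => w x y ^ 2) v1 v2 L x y =
  segment_integral (fun x y => w x y ^ 2) v1 v2 L (x - t * v2) (y + t * v1) +
  RInt (fun s => w (x + s * v1 - t * v2) (y + s * v2 + t * v1) *
                 w (x + s * v1 + t * v2) (y + s * v2 - t * v1)) 0 L.
Proof.
destruct (ex_diff_2_continuously_differentiable w w_C2) as (Hw & Hw1 & Hw2).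
assert (Cw := proj1 (proj2 (proj2 Hw))).
assert (Cw1 := proj1 (proj2 (proj2 Hw1))).
assert (Cw2 := proj1 (proj2 (proj2 Hw2))).
destruct Hw1 as (Dw11 & Dw12 & Hw1).
assert (Cw11 := proj1 (proj2 Hw1)). assert (Cw12 := proj2 (proj2 Hw1)).
destruct Hw2 as (Dw21 & Dw22 & Hw2).
assert (Cw21 := proj1 (proj2 Hw2)). assert (Cw22 := proj2 (proj2 Hw2)).
set (X := fun s t => x + s * v1 - t * v2).
set (Y := fun s t => y + s * v2 + t * v1).
set (w1 := partial1 w) in *; set (w2 := partial2 w) in *.
set (w11 := partial1 w1) in *; set (w12 := partial2 w1) in *.
set (w21 := partial1 w2) in *; set (w22 := partial2 w2) in *.
assert (CX : jointly_continuous X) by (intros z; unfold X; continuity).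
assert (CY : jointly_continuous Y) by (intros z; unfold Y; continuity).
assert (Pw1 : forall x y, w1 (x + L * v1) (y + L * v2) = w1 x y).
{ intros a b; apply partial1_periodic; [apply Hw | auto]. }
assert (Pw2 : forall x y, w2 (x + L * v1) (y + L * v2) = w2 x y).
{ intros a b; apply partial2_periodic; [apply Hw | auto]. }
assert (PX : forall t, X L t = X 0 t + L * v1) by (intros; unfold X; ring).
assert (PY : forall t, Y L t = Y 0 t + L * v2) by (intros; unfold Y; ring).
assert (Dt : forall (g : R -> R -> R) s t l,
  continuously_differentiable g ->
  - v2 * partial1 g (X s t) (Y s t) + v1 * partial2 g (X s t) (Y s t) = l ->
  is_derive (fun t => g (X s t) (Y s t)) t l).
{ intros g s r l Hg Hl; apply (is_derive_comp_plane g (X s) (Y s) r (- v2) v1);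
    auto; unfold X, Y; auto_derive; auto; ring. }
assert (Ds : forall (g : R -> R -> R) s t l,
  continuously_differentiable g ->
  v1 * partial1 g (X s t) (Y s t) + v2 * partial2 g (X s t) (Y s t) = l ->
  is_derive (fun s => g (X s t) (Y s t)) s l).
{ intros g s r l Hg Hl.
  apply (is_derive_comp_plane g (fun s => X s r) (fun s => Y s r) s v1 v2);
    auto; unfold X, Y; auto_derive; auto; ring. }
generalize (wave_parallelogram
  (fun s t => w (X s t) (Y s t))
  (fun s t => - v2 * w1 (X s t) (Y s t) + v1 * w2 (X s t) (Y s t))
  (fun s t => - v2 * (- v2 * w11 (X s t) (Y s t) + v1 * w12 (X s t) (Y s t)) +
              v1 * (- v2 * w21 (X s t) (Y s t) + v1 * w22 (X s t) (Y s t)))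
  (fun s t => v1 * w1 (X s t) (Y s t) + v2 * w2 (X s t) (Y s t))
  (fun s t => v1 * (v1 * w11 (X s t) (Y s t) + v2 * w12 (X s t) (Y s t)) +
              v2 * (v1 * w21 (X s t) (Y s t) + v2 * w22 (X s t) (Y s t)))
  L (lambda ^ 2) t).
intros E.
(* Whole copies for [Dt] and [Ds]: those for the first partials were taken apart above for their
   continuity components. *)
destruct (ex_diff_2_continuously_differentiable w w_C2) as (Kw & Kw1 & Kw2).
lapply E; clear E; [intros E | intros z; continuity].
lapply E; clear E; [intros E | intros z; continuity].
lapply E; clear E; [intros E | intros z; continuity].
lapply E; clear E; [intros E | intros z; continuity].
lapply E; clear E; [intros E | intros z; continuity].
lapply E; clear E; [intros E | intros s r; now apply Dt].
lapply E; clear E; [intros E | intros s r].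
2: { apply (is_derive_plus (V := R_NormedModule)); apply is_derive_scal;
     now apply Dt. }
lapply E; clear E; [intros E | intros s r; now apply Ds].
lapply E; clear E; [intros E | intros s r].
2: { apply (is_derive_plus (V := R_NormedModule)); apply is_derive_scal;
     now apply Ds. }
lapply E; clear E; [intros E | intros s r].
(* In the sum of the two second derivatives the [w12] terms cancel each other, and so do the [w21]
   terms. The unit length of the direction normalizes the rest. *)
2: { rewrite <- w_eigen.
     change (real_laplacian w (X s r) (Y s r))
       with (w11 (X s r) (Y s r) + w22 (X s r) (Y s r)).
     replace (w11 (X s r) (Y s r) + w22 (X s r) (Y s r))
       with ((v1 ^ 2 + v2 ^ 2) * (w11 (X s r) (Y s r) + w22 (X s r) (Y s r)))
       by (rewrite v_unit; ring).
     ring. }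
lapply E; clear E; [intros E | intros r; now rewrite PX, PY, w_periodic].
lapply E; clear E; [intros E | intros r; now rewrite PX, PY, Pw1, Pw2].
revert E; unfold segment_integral, X, Y; intros E.
etransitivity; [etransitivity; [| exact E] |];
  f_equal; apply RInt_ext; intros s _;
  repeat (f_equal; try ring).
Qed.

(** In the integral of [(u1 - u2) ^ 2 + (u3 + u0) ^ 2], the parallelogram identity replaces the
    cross terms by twice the integral of [u1 ^ 2 - u0 ^ 2]. This raises the coefficient of [u1 ^ 2]
    from 1 to 3 and turns that of [u0 ^ 2] from 1 to -1. *)
Lemma segment_integral_line x y t :
  segment_integral (fun x y => w x y ^ 2) v1 v2 L x y <=
  3 * segment_integral (fun x y => w x y ^ 2) v1 v2 L (x - t * v2) (y + t * v1) +
  segment_integral (fun x y => w x y ^ 2) v1 v2 L (x + t * v2) (y - t * v1) +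
  segment_integral (fun x y => w x y ^ 2) v1 v2 L
    (x - 2 * t * v2) (y + 2 * t * v1).
Proof.
assert (E := segment_integral_parallelogram x y t).
destruct (ex_diff_2_continuously_differentiable w w_C2) as [Hw _].
assert (Cw := proj1 (proj2 (proj2 Hw))).
unfold segment_integral in *.
set (u0 := fun s => w (x + s * v1) (y + s * v2)).
set (u1 := fun s => w (x - t * v2 + s * v1) (y + t * v1 + s * v2)).
set (u2 := fun s => w (x + t * v2 + s * v1) (y - t * v1 + s * v2)).
set (u3 := fun s => w (x - 2 * t * v2 + s * v1) (y + 2 * t * v1 + s * v2)).
assert (C0 : forall s, continuous u0 s) by (intros s; unfold u0; continuity).
assert (C1 : forall s, continuous u1 s) by (intros s; unfold u1; continuity).
assert (C2 : forall s, continuous u2 s) by (intros s; unfold u2; continuity).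
assert (C3 : forall s, continuous u3 s) by (intros s; unfold u3; continuity).
assert (Hex : forall f : R -> R, (forall x, continuous f x) -> ex_RInt f 0 L).
{ intros f Hf; now apply ex_RInt_continuous_global. }
assert (Hplus : forall f g : R -> R,
  (forall x, continuous f x) -> (forall x, continuous g x) ->
  RInt (fun s => f s + g s) 0 L = RInt f 0 L + RInt g 0 L).
{ intros f g Hf Hg; apply (RInt_plus f g); auto. }
assert (Hscal : forall (f : R -> R) c, (forall x, continuous f x) ->
  RInt (fun s => c * f s) 0 L = c * RInt f 0 L).
{ intros f c Hf; apply (RInt_scal f); auto. }
(* 2 (u1^2 + u1 u2 - u3 u0 - u0^2) <= 3 u1^2 + u2^2 + u3^2 - u0^2 *)
assert (Hsquares : 0 <= RInt (fun s => (u1 s - u2 s) ^ 2 + (u3 s + u0 s) ^ 2) 0 L).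
{ apply RInt_ge_0; auto.
  - apply Hex; intros r; continuity.
  - intros r _; apply Rplus_le_le_0_compat; apply pow2_ge_0. }
rewrite (RInt_ext _ (fun s => (u1 s ^ 2 + u2 s ^ 2) + (u3 s ^ 2 + u0 s ^ 2) +
                              (2 * (u3 s * u0 s) + -2 * (u1 s * u2 s))))
  in Hsquares.
2: { intros s _; real_eq; ring. }
rewrite !Hplus, !Hscal in Hsquares by (intros s; continuity).
rewrite (RInt_ext (fun s => w (x + s * v1 - 2 * t * v2) (y + s * v2 + 2 * t * v1) *
                            w (x + s * v1) (y + s * v2))
                  (fun s => u3 s * u0 s)) in E.
2: { intros s _; unfold u3, u0; f_equal; f_equal; ring. }
rewrite (RInt_ext (fun s => w (x + s * v1 - t * v2) (y + s * v2 + t * v1) *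
                            w (x + s * v1 + t * v2) (y + s * v2 - t * v1))
                  (fun s => u1 s * u2 s)) in E.
2: { intros s _; unfold u1, u2; f_equal; f_equal; ring. }
change (fun s => w (x + s * v1) (y + s * v2) ^ 2) with (fun s => u0 s ^ 2) in *.
change (fun s => w (x - t * v2 + s * v1) (y + t * v1 + s * v2) ^ 2)
  with (fun s => u1 s ^ 2) in *.
change (fun s => w (x + t * v2 + s * v1) (y - t * v1 + s * v2) ^ 2)
  with (fun s => u2 s ^ 2) in *.
change (fun s => w (x - 2 * t * v2 + s * v1) (y + 2 * t * v1 + s * v2) ^ 2)
  with (fun s => u3 s ^ 2) in *.
lra.
Qed.

(** Split [(a, b)] into a part [s] along the segment and a part [t] across it. Sliding invariance
    removes the first, which leaves the one-parameter inequality. *)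
Lemma segment_integral_plane x y a b :
  segment_integral (fun x y => w x y ^ 2) v1 v2 L x y <=
  3 * segment_integral (fun x y => w x y ^ 2) v1 v2 L (x + a) (y + b) +
  segment_integral (fun x y => w x y ^ 2) v1 v2 L (x - a) (y - b) +
  segment_integral (fun x y => w x y ^ 2) v1 v2 L (x + 2 * a) (y + 2 * b).
Proof.
destruct (ex_diff_2_continuously_differentiable w w_C2) as [Hw _].
assert (Cw := proj1 (proj2 (proj2 Hw))).
assert (P : forall x y r,
  segment_integral (fun x y => w x y ^ 2) v1 v2 L (x + r * v1) (y + r * v2) =
  segment_integral (fun x y => w x y ^ 2) v1 v2 L x y).
{ intros x' y' r; apply segment_integral_periodic.
  - intros z; continuity.
  - intros x'' y''; now rewrite w_periodic. }
set (s := a * v1 + b * v2).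
set (t := b * v1 - a * v2).
assert (Ha : a = s * v1 - t * v2).
{ unfold s, t; replace a with (a * (v1 ^ 2 + v2 ^ 2)) at 1
    by (rewrite v_unit; ring); ring. }
assert (Hb : b = s * v2 + t * v1).
{ unfold s, t; replace b with (b * (v1 ^ 2 + v2 ^ 2)) at 1
    by (rewrite v_unit; ring); ring. }
replace (x + a) with (x - t * v2 + s * v1) by (rewrite Ha; ring).
replace (y + b) with (y + t * v1 + s * v2) by (rewrite Hb; ring).
replace (x - a) with (x + t * v2 + - s * v1) by (rewrite Ha; ring).
replace (y - b) with (y - t * v1 + - s * v2) by (rewrite Hb; ring).
replace (x + 2 * a) with (x - 2 * t * v2 + (2 * s) * v1) by (rewrite Ha; ring).
replace (y + 2 * b) with (y + 2 * t * v1 + (2 * s) * v2) by (rewrite Hb; ring).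
rewrite !P; apply segment_integral_line.
Qed.

End Segment.

(** * Straight-line geodesics, real and imaginary parts, and the restriction bound *)

Lemma derive_constant_affine (g : R -> R) :
  (forall t, ex_derive g t) -> (forall t, is_derive (Derive g) t 0) ->
  forall t, g t = g 0 + t * Derive g 0.
Proof.
intros Dg Dg' t.
assert (E : g t - t * Derive g 0 = g 0 - 0 * Derive g 0).
{ apply (is_derive_zero_const (fun t => g t - t * Derive g 0)); intros x.
  evar_last.
  - apply (is_derive_minus (V := R_NormedModule)).
    + apply Derive_correct, Dg.
    + apply (is_derive_Rmult (fun t => t) (fun _ => Derive g 0) x 1 0 (Derive g 0)).
      * apply (is_derive_id x).
      * apply (is_derive_const (Derive g 0) x).
      * ring.
  - rewrite (is_derive_zero_const (Derive g) Dg' x 0); apply Rminus_diag. }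
lra.
Qed.

Lemma periodic_IZR (f : R -> R) (T : R) :
  (forall x, f (x + T) = f x) -> forall k x, f (x + T * IZR k) = f x.
Proof.
intros Hf.
assert (Hnat : forall n x, f (x + T * INR n) = f x).
{ induction n as [|n IHn]; intros x.
  - simpl; f_equal; ring.
  - rewrite S_INR, <- (IHn x), <- (Hf (x + T * INR n)); f_equal; ring. }
intros k x; destruct (Z_le_dec 0 k) as [Hk | Hk].
- rewrite <- (Z2Nat.id k Hk), <- INR_IZR_INZ; apply Hnat.
- replace k with (- Z.of_nat (Z.to_nat (- k)))%Z by lia.
  rewrite opp_IZR, <- INR_IZR_INZ, <- (Hnat (Z.to_nat (- k))); f_equal; ring.
Qed.

(** The Laplacian acts componentwise and the eigenvalue is real, so the complex equation splits into
    two real ones. *)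
Lemma eigenfunction_parts (lambda : R) (e : R -> R -> C) (w : R -> R -> R) :
  eigenfunction lambda e ->
  w = (fun x y => Re (e x y)) \/ w = (fun x y => Im (e x y)) ->
  (forall x y, ex_diff_n w 2 x y) /\
  (forall x y, real_laplacian w x y = - lambda ^ 2 * w x y) /\
  (forall x y, w (x + 2 * PI) y = w x y) /\
  (forall x y, w x (y + 2 * PI) = w x y).
Proof.
intros (He & HC & Heig) [-> | ->];
  (split; [intros x y; apply HC | split]).
2, 4: split; intros x y;
  [now rewrite (proj1 (He x y)) | now rewrite (proj2 (He x y))].
- intros x y; assert (H := f_equal Re (Heig x y)).
  unfold laplacian, Copp, Cmult, RtoC, Re in H; simpl in H.
  unfold Re; lra.
- intros x y; assert (H := f_equal Im (Heig x y)).
  unfold laplacian, Copp, Cmult, RtoC, Im in H; simpl in H.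
  unfold Im; lra.
Qed.

Theorem corollary1 (gamma : R -> R * R) (len : R)
    (Hgamma : closed_geodesic gamma len) :
  exists C_Sigma : R, 0 < C_Sigma /\
    forall (lambda : R) (e : R -> R -> C),
      1 < lambda -> eigenfunction lambda e ->
      L2_norm_curve gamma len e <= C_Sigma * L2_norm_torus e.
Proof.
destruct Hgamma as (Hgeo & Hlen & Hper & _).
set (g1 := fun t => fst (gamma t)); set (g2 := fun t => snd (gamma t)).
set (v1 := Derive g1 0); set (v2 := Derive g2 0).
assert (Hg1 : forall t, g1 t = g1 0 + t * v1).
{ apply derive_constant_affine; intros t; apply (Hgeo t). }
assert (Hg2 : forall t, g2 t = g2 0 + t * v2).
{ apply derive_constant_affine; intros t; apply (Hgeo t). }
assert (Hv : v1 ^ 2 + v2 ^ 2 = 1) by apply (Hgeo 0).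
(* Closedness makes the displacement [(len * v1, len * v2)] equal to [2 * PI] times the integer
   vector [(k, l)], hence a period of every function on the torus. *)
destruct (Hper 0) as (k & l & Hk & Hl).
rewrite Rplus_0_l in Hk, Hl.
change (g1 len = g1 0 + 2 * PI * IZR k) in Hk.
change (g2 len = g2 0 + 2 * PI * IZR l) in Hl.
assert (HPI := PI_RGT_0).
assert (Hc : 0 < 5 * len / (2 * PI) ^ 2).
{ apply Rdiv_lt_0_compat; [lra | apply pow_lt; lra]. }
(* The averaging bound compares squared norms with factor [5 * len / (2 * PI) ^ 2]. *)
exists (sqrt (5 * len / (2 * PI) ^ 2)); split; [now apply sqrt_lt_R0 |].
intros lambda e _ He.
set (u := fun x y => Re (e x y)); set (v := fun x y => Im (e x y)).
destruct (eigenfunction_parts lambda e u He (or_introl eq_refl))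
  as (u_C2 & u_eig & u_per1 & u_per2).
destruct (eigenfunction_parts lambda e v He (or_intror eq_refl))
  as (v_C2 & v_eig & v_per1 & v_per2).
assert (Hshift : forall w : R -> R -> R,
  (forall x y, w (x + 2 * PI) y = w x y) ->
  (forall x y, w x (y + 2 * PI) = w x y) ->
  forall x y, w (x + len * v1) (y + len * v2) = w x y).
{ intros w H1 H2 x y.
  replace (len * v1) with (2 * PI * IZR k) by (rewrite Hg1 in Hk; lra).
  replace (len * v2) with (2 * PI * IZR l) by (rewrite Hg2 in Hl; lra).
  rewrite (periodic_IZR (fun x => w x (y + 2 * PI * IZR l)) (2 * PI)) by auto.
  now apply (periodic_IZR (w x)). }
assert (Cu := proj1 (proj2 (proj2 (proj1
                (ex_diff_2_continuously_differentiable u u_C2))))).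
assert (Cv := proj1 (proj2 (proj2 (proj1
                (ex_diff_2_continuously_differentiable v v_C2))))).
set (F := fun x y => u x y ^ 2 + v x y ^ 2).
assert (CF : jointly_continuous F) by (intros z; unfold F; continuity).
assert (HF : forall x y, Cmod (e x y) ^ 2 = F x y).
{ intros x y; unfold Cmod; rewrite pow2_sqrt; [reflexivity |].
  apply Rplus_le_le_0_compat; apply pow2_ge_0. }
assert (Hmain : (2 * PI) ^ 2 * segment_integral F v1 v2 len (g1 0) (g2 0) <=
                5 * len *
                RInt (fun x => RInt (fun y => F x y) 0 (2 * PI)) 0 (2 * PI)).
{ apply segment_integral_average; auto; try lra.
  - intros x y; unfold F; now rewrite u_per1, v_per1.
  - intros x y; unfold F; now rewrite u_per2, v_per2.
  (* The inequality is linear in the squared function, so those for the real and imaginary parts add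
     up to one for the squared modulus. *)
  - intros a b; unfold F.
    rewrite !segment_integral_plus by (intros z; continuity).
    assert (Hu := segment_integral_plane u v1 v2 len lambda u_C2 u_eig Hv
                    (Hshift u u_per1 u_per2) (Rlt_le _ _ Hlen) (g1 0) (g2 0) a b).
    assert (Hw := segment_integral_plane v v1 v2 len lambda v_C2 v_eig Hv
                    (Hshift v v_per1 v_per2) (Rlt_le _ _ Hlen) (g1 0) (g2 0) a b).
    lra. }
unfold L2_norm_curve, L2_norm_torus.
rewrite <- sqrt_mult_alt by lra.
apply sqrt_le_1_alt.
rewrite (RInt_ext _ (fun s => F (g1 0 + s * v1) (g2 0 + s * v2))).
2: { intros s _; rewrite HF, <- Hg1, <- Hg2; reflexivity. }
rewrite (RInt_ext (fun x => RInt (fun y => Cmod (e x y) ^ 2) 0 (2 * PI))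
                  (fun x => RInt (fun y => F x y) 0 (2 * PI))).
2: { intros x _; apply RInt_ext; intros y _; apply HF. }
change (RInt (fun s => F (g1 0 + s * v1) (g2 0 + s * v2)) 0 len)
  with (segment_integral F v1 v2 len (g1 0) (g2 0)).
apply Rmult_le_reg_l with ((2 * PI) ^ 2); [apply pow_lt; lra |].
eapply Rle_trans; [exact Hmain | right].
real_eq; field; lra.
Qed.
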